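(* For every fixed positive integer $k$, $\alpha_{d,k}=\Omega\!\left(\frac{1}{\sqrt[k]{d+1}}\right)$ as $d\to\infty$; that is, there is a constant $c_k>0$ such that $\alpha_{d,k}\ge c_k (d+1)^{-1/k}$ for all $d$ with $k\le d+1$.
   Context: For a finite family $\mathcal{F}$ of convex sets in $\mathbb{R}^d$ and $p\in\mathbb{R}^d$, $\operatorname{dep}_\mathcal{F}(p)$ is the smallest number of sets of $\mathcal{F}$ intersected by a closed halfspace containing $p$. A family is $k$-intersecting if every subfamily of at most $k$ of its members has nonempty intersection. For a positive integer $d$ and an integer $1\le k\le d+1$, $\alpha_{d,k}$ is the largest real number such that every finite $k$-intersecting family $\mathcal{F}$ of convex sets in $\mathbb{R}^d$ has a point $p$ with $\operatorname{dep}_\mathcal{F}(p)\ge \alpha_{d,k}\cdot|\mathcal{F}|$. *)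

(* Defs.v *)
From mathcomp Require Import all_boot all_order all_algebra.
From mathcomp Require Import boolp classical_sets functions reals convex exp.

Set Implicit Arguments.
Unset Strict Implicit.
Unset Printing Implicit Defensive.

Import Order.TTheory GRing.Theory Num.Theory.

Local Open Scope classical_set_scope.
Local Open Scope ring_scope.

(* A finite family of subsets of R^d is an indexed family [F : I -> set 'rV_d]
   with [I] a finType: members may be repeated, and cardinalities (of the
   family, of its subfamilies, of the members meeting a set) are counted on
   indices. *)

Definition closed_halfspace (R : realType) (d : nat) (H : set 'rV[R]_d) : Prop :=
  exists (a : 'rV[R]_d) (b : R),
    a != 0 /\ H = [set x | b <= \sum_j a 0 j * x 0 j].

Definition hits (R : realType) (d : nat) (I : finType)
    (F : I -> set 'rV[R]_d) (H : set 'rV[R]_d) : {set I} :=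
  [set i | `[< F i `&` H !=set0 >]]%SET.

(* The minimum is taken over the finitely many index sets [J] that are of the
   form [hits F H]; the default value [#|I|] is an upper bound of all the
   [#|J|], so it only matters when there is no halfspace, that is d = 0. *)
Definition dep (R : realType) (d : nat) (I : finType)
    (F : I -> set 'rV[R]_d) (p : 'rV[R]_d) : nat :=
  \big[minn/#|I|]_(J : {set I} |
      `[< exists H, [/\ closed_halfspace H, H p & J = hits F H] >]) #|J|.

Definition k_intersecting (R : realType) (d : nat) (I : finType) (k : nat)
    (F : I -> set 'rV[R]_d) : Prop :=
  forall J : {set I}, (#|J| <= k)%N -> \bigcap_(i in [set` J]) F i !=set0.

Definition depth_ratio (R : realType) (d k : nat) : set R :=
  [set t | forall (n : nat) (F : 'I_n -> set 'rV[R]_d),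
    (forall i, convex_set (F i)) -> k_intersecting k F ->
    exists p : 'rV[R]_d, t * n%:R <= (dep F p)%:R].

Arguments depth_ratio R d k : clear implicits.

(* By [alphaP] this supremum is a maximum. *)
Definition alpha (R : realType) (d k : nat) : R := sup (depth_ratio R d k).

Lemma dep_le_hits (R : realType) (d : nat) (I : finType)
    (F : I -> set 'rV[R]_d) (p : 'rV[R]_d) (H : set 'rV[R]_d) :
  closed_halfspace H -> H p -> (dep F p <= #|hits F H|)%N.
Proof.
move=> hH Hp; rewrite /dep -minEnat -leEnat; apply: bigmin_le_cond.
by apply/asboolP; exists H.
Qed.

Lemma dep_le_card (R : realType) (d : nat) (I : finType)
    (F : I -> set 'rV[R]_d) (p : 'rV[R]_d) : (dep F p <= #|I|)%N.
Proof.
rewrite /dep; elim/big_rec: _ => // J m _ h.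
exact: leq_trans (geq_minr _ _) h.
Qed.

Lemma dep_attained (R : realType) (d : nat) (I : finType)
    (F : I -> set 'rV[R]_d) (p : 'rV[R]_d) :
  (0 < d)%N ->
  exists H, [/\ closed_halfspace H, H p & dep F p = #|hits F H|].
Proof.
move=> d0; pose a : 'rV[R]_d := const_mx 1.
pose H0 : set 'rV[R]_d :=
  [set x | \sum_j a 0 j * p 0 j <= \sum_j a 0 j * x 0 j].
have hH0 : closed_halfspace H0.
  exists a, (\sum_j a 0 j * p 0 j); split=> //.
  apply/eqP => /matrixP /(_ 0 (Ordinal d0)) /eqP.
  by rewrite !mxE oner_eq0.
have [E|[H]] : dep F p = #|I| \/
    exists H, [/\ closed_halfspace H, H p & dep F p = #|hits F H|].
- rewrite /dep; elim/big_rec: _ => [|J m /asboolP[H [hH Hp ->]] IH]; first by left.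
  have [h|h] := leqP #|hits F H| m; first by right; exists H.
  by case: IH => [->|[H' hH']]; [left|right; exists H'].
- exists H0; split=> //; first exact: lexx.
  apply/eqP; rewrite eqn_leq dep_le_hits //=; last exact: lexx.
  by rewrite E max_card.
- by exists H.
Qed.

Lemma alphaP (R : realType) (d k : nat) :
  depth_ratio R d k (alpha R d k) /\ ubound (depth_ratio R d k) (alpha R d k).
Proof.
have S0 : depth_ratio R d k !=set0.
  by exists 0 => n F _ _; exists 0; rewrite mul0r ler0n.
have Sub : has_ubound (depth_ratio R d k).
  exists 1 => t /(_ 1%N (fun=> setT)) [|J _|p].
  - by move=> _ x y l _ _; rewrite inE.
  - by exists 0.
  - rewrite mulr1 => /le_trans; apply.
    by rewrite (ler_nat _ _ 1) -[X in (_ <= X)%N](card_ord 1) dep_le_card.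
split; last exact: ub_le_sup.
move=> n; case: (posnP n) => [->|n0] F cF kF.
  by exists 0; rewrite mulr0 ler0n.
pose P m := `[< exists p, dep F p = m >].
have exP : exists m, P m by exists (dep F 0); apply/asboolP; exists 0.
have bP m : P m -> (m <= n)%N.
  by move=> /asboolP[p <-]; rewrite -[X in (_ <= X)%N](card_ord n) dep_le_card.
have [m /asboolP[p pm] maxm] := ex_maxnP exP bP.
exists p; rewrite -ler_pdivlMr ?ltr0n //; apply: ge_sup => // t /(_ n F cF kF)[q].
rewrite -ler_pdivlMr ?ltr0n // => /le_trans; apply.
rewrite ler_pM2r ?invr_gt0 ?ltr0n // ler_nat pm; apply: maxm.
by apply/asboolP; exists q.
Qed.

(* Main.v *)
(* For each k-tuple of indices choose a point common to the corresponding
   members; these are n^k points, counted with multiplicity.  A closed halfspace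
   containing their centerpoint contains at least n^k/(d+1) of them, and meets
   every member involved in such a point.  Hence, if it meets m members,
   n^k <= (d+1) m^k, so c_k = 1 works. *)

Require Import Defs.
From mathcomp Require Import all_boot all_order all_algebra.
From mathcomp Require Import boolp classical_sets functions reals convex exp.
From mathcomp Require Import interval_inference ring.

Set Implicit Arguments.
Unset Strict Implicit.
Unset Printing Implicit Defensive.

Import Order.TTheory GRing.Theory Num.Theory.
Local Open Scope ring_scope.
Local Open Scope classical_set_scope.

Lemma convex_setP (R : realType) (M : lmodType R) (A : set M) :
  convex_set A <->
  forall (x y : M) (a b : R), 0 <= a -> 0 <= b -> a + b = 1 ->
    A x -> A y -> A (a *: x + b *: y).
Proof.
split=> [cA x y a b a0 b0 ab Ax Ay | cA x y t].
  have a1 : a <= 1 by rewrite -ab lerDl.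
  have := cA x y (Itv01 a0 a1); rewrite !inE => /(_ Ax Ay).
  by rewrite /conv/= /unstable.onem -ab [a + b]addrC addrK.
rewrite !inE => Ax Ay; apply: cA => //; first by rewrite unstable.onem_ge0.
exact: unstable.add_onemK.
Qed.

(* Accumulating the terms one by one keeps the total weight positive, hence
   invertible, at every step. *)
Lemma convex_weighted_sum (R : realType) (M : lmodType R) (A : set M)
    (I : Type) (r : seq I) (P : pred I) (w : I -> R) (x : I -> M)
    (a : R) (y : M) :
  convex_set A -> 0 < a -> A y ->
  (forall i, P i -> 0 <= w i) -> (forall i, P i -> A (x i)) ->
  A ((a + \sum_(i <- r | P i) w i)^-1 *:
     (a *: y + \sum_(i <- r | P i) w i *: x i)).
Proof.
move=> /convex_setP cA a0 Ay w0 Ax; elim: r a y a0 Ay => [|i r IH] a y a0 Ay.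
  by rewrite !big_nil !addr0 scalerA mulVf ?scale1r ?gt_eqF.
rewrite !big_cons; case: ifP => Pi; last exact: IH.
have wi := w0 _ Pi; have awi : 0 < a + w i by rewrite ltr_wpDr.
have nz : a + w i != 0 by rewrite gt_eqF.
have := IH (a + w i) ((a / (a + w i)) *: y + (w i / (a + w i)) *: x i) awi.
rewrite [(a + w i) *: _]scalerDr !scalerA ![(a + w i) * _]mulrC !divfK //.
rewrite -!addrA; apply.
apply: cA => //; last exact: Ax.
- by rewrite divr_ge0 // ltW.
- by rewrite divr_ge0 // ltW.
- by rewrite -mulrDl divff.
Qed.

(** Radon's argument yields weights that need not sum to 1, hence the normalisation. A positive
    total forces some positive weight, and that term starts the accumulation. *)
Lemma convex_barycenter (R : realType) (M : lmodType R) (A : set M)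
    (I : finType) (P : pred I) (w : I -> R) (x : I -> M) :
  convex_set A -> 0 < \sum_(i | P i) w i ->
  (forall i, P i -> 0 <= w i) -> (forall i, P i -> A (x i)) ->
  A ((\sum_(i | P i) w i)^-1 *: \sum_(i | P i) w i *: x i).
Proof.
move=> cA s0 w0 Ax.
have [i /andP[Pi wi]] : exists i, P i && (0 < w i).
  apply/existsP; apply: contraLR s0 => /existsPn h.
  rewrite -leNgt; apply: sumr_le0 => i Pi.
  by have := h i; rewrite Pi /= -leNgt.
rewrite !(bigD1 i Pi) /=; apply: convex_weighted_sum => //; first exact: Ax.
- by move=> j /andP[/w0].
- by move=> j /andP[/Ax].
Qed.

(** Appending a coordinate 1 to each point gives more than [d + 1] vectors in dimension [d + 1]. In
    a linear relation between them, the last coordinate says that the coefficients sum to 0. *)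
Lemma affine_dependence (F : fieldType) (d : nat) (I : finType) (K : {set I})
    (x : I -> 'rV[F]_d) :
  (d.+1 < #|K|)%N ->
  exists l : I -> F, [/\ \sum_(i in K) l i = 0, \sum_(i in K) l i *: x i = 0
    & exists2 i, i \in K & l i != 0].
Proof.
move=> cK; have /card_gt0P[i0 Ki0] : (0 < #|K|)%N by apply: leq_trans cK.
pose M := \matrix_(i < #|K|) row_mx (x (enum_val i)) (1%:M : 'rV[F]_1).
have : kermx M != 0.
  rewrite kermx_eq0 /row_free neq_ltn (leq_ltn_trans (rank_leq_col M)) //.
  by rewrite addn1.
case/rowV0Pn => u /sub_kermxP uM unz.
have [j uj] : exists j, u 0 j != 0.
  apply/existsP; apply: contraNT unz => /existsPn h.
  by apply/eqP/rowP => j; rewrite mxE; have := h j; rewrite negbK => /eqP.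
have E : \sum_j u 0 j *: row_mx (x (enum_val j)) (1%:M : 'rV[F]_1) = 0.
  by rewrite -[RHS]uM mulmx_sum_row; apply: eq_bigr => i _; rewrite rowK.
exists (fun i => u 0 (enum_rank_in Ki0 i)).
split; last by exists (enum_val j); rewrite ?enum_valP // enum_valK_in.
- rewrite big_enum_val /=.
  move/(congr1 (fun v => rsubmx v 0 0)): E; rewrite linear_sum summxE /= !mxE.
  move=> E; rewrite -[RHS]E; apply: eq_bigr => i _.
  by rewrite linearZ /= row_mxKr enum_valK_in !mxE mulr1.
- rewrite big_enum_val /=.
  move/(congr1 lsubmx): E; rewrite linear_sum /= linear0 => E.
  rewrite -[RHS]E; apply: eq_bigr => i _.
  by rewrite linearZ /= row_mxKl enum_valK_in.
Qed.

(** Taken as the intersection of all convex supersets, so that a hull point is exploited by choosing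
    one convex set. *)
Definition convex_hull (R : realType) (d : nat) (S : set 'rV[R]_d) :
    set 'rV[R]_d :=
  [set p | forall C : set 'rV[R]_d, convex_set C -> S `<=` C -> C p].

Lemma convex_hull_convex (R : realType) (d : nat) (S : set 'rV[R]_d) :
  convex_set (convex_hull S).
Proof.
apply/convex_setP => x y a b a0 b0 ab hx hy C cC SC.
by move/convex_setP: (cC); apply => //; [apply: hx | apply: hy].
Qed.

(** Split an affine dependence by sign: the positive coefficients and the negated remaining ones
    have the same total and the same weighted sum, hence the same barycenter. *)
Lemma radon (R : realType) (d : nat) (I : finType) (K : {set I})
    (x : I -> 'rV[R]_d) :
  (d.+1 < #|K|)%N ->
  exists2 J : {set I}, J \subset K &
    convex_hull (x @` [set` J]) `&` convex_hull (x @` [set` K :\: J]) !=set0.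
Proof.
move=> /(affine_dependence x)[l [s0 sx0 [i0 Ki0 li0]]].
pose J := [set i in K | 0 < l i].
have JK : J \subset K by apply/fintype.subsetP => i; rewrite inE => /andP[].
move: s0; rewrite (big_setID J) /= (finset.setIidPr JK).
move/(canRL (addrK _)); rewrite add0r -sumrN => s0.
move: sx0; rewrite (big_setID J) /= (finset.setIidPr JK).
move/(canRL (addrK _)); rewrite add0r -sumrN => sx0.
have J0 i : i \in J -> 0 <= l i by rewrite inE => /andP[_ /ltW].
have KJ0 i : i \in K :\: J -> 0 <= - l i.
  by rewrite !inE oppr_ge0 leNgt => /andP[+ iK]; rewrite iK.
(* If this total vanished, so would the equal total of the [- l i] over [K :\: J]. Both sums have
   nonnegative terms, so [l] would be 0 on all of [K]. *)
have L0 : 0 < \sum_(i in J) l i.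
  rewrite lt_def sumr_ge0 // andbT; apply: contraNneq li0 => L0.
  have [iJ|iJ] := boolP (i0 \in J); first by rewrite (psumr_eq0P J0).
  rewrite -oppr_eq0; apply/eqP.
  by rewrite (psumr_eq0P KJ0 _) -?s0 // inE iJ.
exists J => //.
exists ((\sum_(i in J) l i)^-1 *: \sum_(i in J) l i *: x i); split=> C cC SC.
  by apply: convex_barycenter => // i iJ; apply: SC; exists i.
rewrite s0 sx0.
under [X in _ *: X]eq_bigr do rewrite -scaleNr.
by apply: convex_barycenter; rewrite -?s0 // => i iJ; apply: SC; exists i.
Qed.

(** Induction on [#|K|]: leaving out [i] gives a point [x i] common to the other members, and a
    Radon point of these points lies in every member. *)
Lemma helly (R : realType) (d : nat) (I : finType) (A : I -> set 'rV[R]_d)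
    (K : {set I}) :
  (forall i, i \in K -> convex_set (A i)) ->
  (forall L : {set I}, L \subset K -> (#|L| <= d.+1)%N ->
    \bigcap_(i in [set` L]) A i !=set0) ->
  \bigcap_(i in [set` K]) A i !=set0.
Proof.
move=> cA small; have [n] := ubnP #|K|.
elim: n K cA small => // n IH K cA small Kn.
have [|cK] := leqP #|K| d.+1; first exact: small.
have pt i : exists p, i \in K -> (\bigcap_(j in [set` K :\ i]) A j) p.
  have [iK|] := boolP (i \in K); last by exists 0.
  have [|||p hp] := IH (K :\ i)%SET.
  - by move=> j /setD1P[_ /cA].
  - by move=> L /subsetD1P[LK _]; apply: small.
  - by rewrite (cardsD1 i) iK in Kn.
  by exists p.
have [x hx] := choice pt.
have [J JK [p [pJ pKJ]]] := radon x cK.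
exists p => j /= jK.
(* Only [x j] may fail to lie in [A j], so the side of the Radon partition without [j] has its hull
   inside [A j]. *)
have [jJ|jJ] := boolP (j \in J).
  apply: pKJ; first exact: cA.
  move=> _ [i /= /setDP[iK iJ] <-]; apply: hx => //=.
  by rewrite !inE jK andbT; apply: contraNneq iJ => <-.
apply: pJ; first exact: cA.
move=> _ [i /= iJ <-]; apply: hx => /=; first exact: (fintype.subsetP JK).
by rewrite !inE jK andbT; apply: contraNneq jJ => ->.
Qed.

Lemma closed_halfspaceC_convex (R : realType) (d : nat) (H : set 'rV[R]_d) :
  closed_halfspace H -> convex_set (~` H).
Proof.
move=> [u [c [_ ->]]]; apply/convex_setP => x y a b a0 b0 ab.
rewrite /= => /negP; rewrite -ltNge => ux /negP; rewrite -ltNge => uy.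
apply/negP; rewrite -ltNge.
have -> : \sum_j u 0 j * (a *: x + b *: y) 0 j =
    a * (\sum_j u 0 j * x 0 j) + b * (\sum_j u 0 j * y 0 j).
  by rewrite !mulr_sumr -big_split /=; apply: eq_bigr => j _; rewrite !mxE; ring.
rewrite -[c in _ < c]mul1r -ab mulrDl.
(* Strictness needs a positive coefficient; when [a = 0], it comes from [b = 1]. *)
move: a0; rewrite le_eqVlt => /predU1P[a0|a0].
  by move: ab; rewrite -a0 !mul0r !add0r => ->; rewrite !mul1r.
by apply: ltr_leD; [rewrite ltr_pM2l | rewrite ler_wpM2l // ltW].
Qed.

(* Helly's theorem is applied to the hulls of the subfamilies missing fewer than
   #|T|/(d+1) points: any d+1 of these subfamilies share a point.  A halfspace
   containing too few points would have one of these hulls in its complement. *)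
Lemma centerpoint (R : realType) (d : nat) (T : finType)
    (x : T -> 'rV[R]_d) :
  exists p, forall H, closed_halfspace H -> H p ->
    (#|T| <= d.+1 * #|[set t | `[< H (x t) >]]%SET|)%N.
Proof.
pose K := [set J : {set T} | d.+1 * #|~: J| < #|T|]%SET%N.
have [|L LK cL|p hp] := helly (A := fun J : {set T} => convex_hull (x @` [set` J])) (K := K).
- by move=> J _; apply: convex_hull_convex.
- have [->|/finset.set0Pn[J0 J0L]] := eqVneq L finset.set0; first by exists 0 => J; rewrite /= inE.
  (* At most [d + 1] complements, each smaller than [#|T| / (d + 1)], cannot cover [T]; a point
     outside all of them belongs to every [J] in [L]. *)
  have LT : (\sum_(J in L) d.+1 * #|~: J| < d.+1 * #|T|)%N.
    apply: (@leq_trans (\sum_(J in L) #|T|)%N); last first.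
      by rewrite sum_nat_const leq_mul2r cL orbT.
    have lt J : J \in L -> (d.+1 * #|~: J| < #|T|)%N.
      by move/(fintype.subsetP LK); rewrite inE.
    rewrite !(bigD1 J0 J0L) /= -addSn leq_add ?lt //.
    by apply: leq_sum => J /andP[/lt/ltnW].
  have /card_gt0P[t tL] : (0 < #|~: \bigcup_(J in L) ~: J|)%N.
    rewrite cardsCs finset.setCK subn_gt0.
    move: LT; rewrite -big_distrr ltn_pmul2l //=; apply: leq_ltn_trans.
    elim/big_rec2: _ => [|J m U _ h]; first by rewrite cards0.
    by apply: leq_trans (leq_card_setU _ _) _; rewrite leq_add2l.
  exists (x t) => J /= JL C _; apply; exists t => //=.
  move: tL; rewrite inE; apply: contraNT => tJ.
  by apply/finset.bigcupP; exists J; rewrite ?inE.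
- exists p => H hH Hp; rewrite leqNgt; apply/negP => lt.
  have := hp (~: [set t | `[< H (x t) >]])%SET; rewrite /= inE finset.setCK.
  move=> /(_ lt (~` H) (closed_halfspaceC_convex hH)) []//.
  by move=> _ [t /= + <-]; rewrite !inE => /asboolPn.
Qed.

Lemma depth_pow (R : realType) (d k n : nat) (F : 'I_n -> set 'rV[R]_d) :
  (0 < d)%N -> k_intersecting k F ->
  exists p, (n ^ k <= d.+1 * dep F p ^ k)%N.
Proof.
move=> d0 kF.
(* A tuple may repeat indices, so its image has at most [k] elements. *)
have pt (s : {ffun 'I_k -> 'I_n}) : exists y, forall i, F (s i) y.
  have [|y hy] := kF (s @: [set: 'I_k])%SET.
    by rewrite -[X in (_ <= X)%N](card_ord k) -cardsT leq_imset_card.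
  by exists y => i; apply: hy => /=; apply: imset_f; rewrite inE.
have [x hx] := choice pt.
have [p hp] := centerpoint x; exists p.
have [H [hH Hp ->]] := dep_attained F p d0.
have := hp H hH Hp; rewrite card_ffun !card_ord => /leq_trans; apply.
(* If [x s] lies in [H], then every [F (s i)] meets [H]: such tuples take their values in
   [hits F H]. *)
rewrite leq_mul2l -[X in (_ <= _ ^ X)%N](card_ord k) -card_ffun_on.
apply/orP; right; apply: subset_leq_card; apply/fintype.subsetP => s.
rewrite inE => /asboolP Hs; apply/ffun_onP => i; rewrite inE.
by apply/asboolP; exists (x s).
Qed.

Theorem theorem3 (R : realType) (k : nat) (k_gt0 : (0 < k)%N) :
  exists2 c : R, 0 < c &
    forall d : nat, (0 < d)%N -> (k <= d.+1)%N ->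
      c * (d.+1)%:R `^ (- (k%:R)^-1) <= alpha R d k.
Proof.
exists 1 => // d d0 _; rewrite mul1r; apply: (alphaP R d k).2 => n F _ kF.
have [p hp] := depth_pow d0 kF; exists p.
rewrite powRN mulrC ler_pdivrMr ?powR_gt0 ?ltr0n //.
(* Taking [k]-th powers of both nonnegative sides removes the root and leaves the inequality between
   naturals. *)
rewrite -(ler_pXn2r k_gt0) ?nnegrE ?mulr_ge0 ?powR_ge0 //.
rewrite exprMn -[X in _ <= _ * X]powR_mulrn ?powR_ge0 // -powRrM mulVf ?pnatr_eq0 -?lt0n //.
by rewrite powRr1 // -!natrX -natrM ler_nat mulnC.
Qed.
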